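(* Let $(X,\delta)$ be an approach space. Then $(X,\delta)$ is normal if and only if it satisfies Tietze's extension theorem (in the sense of contractions defined in the context).
   Context: A distance on a set $X$ is a function $\delta:X\times 2^X\to[0,\infty]$ such that for all $x\in X$, $A,B\subseteq X$, $\varepsilon\in[0,\infty]$: (D1) $\delta(x,\{x\})=0$; (D2) $\delta(x,\emptyset)=\infty$; (D3) $\delta(x,A\cup B)=\min\{\delta(x,A),\delta(x,B)\}$; (D4) $\delta(x,A)\le\delta(x,A^{(\varepsilon)})+\varepsilon$, where $A^{(\varepsilon)}=\{x\in X\mid\delta(x,A)\le\varepsilon\}$. The pair $(X,\delta)$ is an approach space. A map $f:(X,\delta_X)\to(Y,\delta_Y)$ between approach spaces is a contraction if $\delta_Y(f(x),f(A))\le\delta_X(x,A)$ for all $x\in X$, $A\subseteq X$. A subset $Y\subseteq X$ carries the restricted distance $\delta|_{Y\times 2^Y}$, still denoted $\delta$. For a metric $d$ on $Z$, $\delta_d(z,A)=\inf_{a\in A}d(z,a)$; $d_{\mathbb E}(x,y)=|x-y|$. For $A\subseteq X$ write $\delta_A(x)=\delta(x,A)$. For a real $\gamma>0$, sets $A,B\subseteq X$ are $\gamma$-separated if $A^{(\alpha)}\cap B^{(\beta)}=\emptyset$ whenever $\alpha\ge0$, $\beta\ge0$ and $\alpha+\beta<\gamma$. A contractive scale is a map $F:\mathbb Q\to 2^X$ with $\bigcup_{q\in\mathbb Q}F(q)=X$ and $\bigcap_{q\in\mathbb Q}F(q)=\emptyset$ such that for all rationals $r<s$ the sets $F(r)$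 and $X\setminus F(s)$ are $(s-r)$-separated. $(X,\delta)$ is normal if for all $A,B\subseteq X$ and all real $\gamma>0$ with $A$ and $B$ $\gamma$-separated, there exists a contractive scale $F$ such that (i) $F(q)=\emptyset$ for all rational $q<0$; (ii) $A\subseteq\bigcap_{q\in\mathbb Q,\,q\ge0}F(q)$; (iii) $B\cap\bigcup_{r\in\mathbb Q\cap\,]0,\gamma]}F(r)=\emptyset$. For $M\subseteq Y$ let $\theta_M:Y\to[0,\infty]$ be $0$ on $M$ and $\infty$ on $Y\setminus M$. A development of a bounded function $f:Y\to[0,\infty]$, indexed by $0<\varepsilon<1$, is a family of functions $\mu_\varepsilon=\bigwedge_{i=1}^{n(\varepsilon)}(m_i^\varepsilon+\theta_{M_i^\varepsilon})$ on $Y$ (pointwise minimum), where for each $\varepsilon$ the finite family $(M_i^\varepsilon)_{i=1}^{n(\varepsilon)}$ is a partition of $Y$ and $m_i^\varepsilon\in[0,\infty[$, such that $\mu_\varepsilon\le f\le\mu_\varepsilon+\varepsilon$ for every $\varepsilon\in\,]0,1[$. Tietze's extension theorem for $(X,\delta)$: for every $Y\subseteq X$, every $\gamma\in[0,\infty[$ and every contraction $f:(Y,\delta)\to([0,\gamma],\delta_{d_{\mathbb E}})$ having a development $\left(\mu_\varepsilon=\bigwedge_{i=1}^{n(\varepsilon)}(m_i^\varepsilon+\theta_{M_i^\varepsilon})\right)_{0<\varepsilon<1}$ such that for all $x\in X\setminus Y$, all $\varepsilon\in\,]0,1[$ and all $1\le l,k\le n(\varepsilon)$, $$m_l^\varepsilon-m_k^\varepsilon\le\delta_{M_k^\varepsilon}(x)+\delta_{M_l^\varepsilon}(x),$$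 there exists a contraction $g:(X,\delta)\to([0,\gamma],\delta_{d_{\mathbb E}})$ with $g|_Y=f$. *)

(* Defs.v *)
From HB Require Import structures.
From mathcomp Require Import all_boot all_order all_algebra.
From mathcomp Require Import all_classical all_reals all_analysis.

Set Implicit Arguments.
Unset Strict Implicit.
Unset Printing Implicit Defensive.

Import Order.TTheory GRing.Theory Num.Theory.
Import numFieldNormedType.Exports.

Local Open Scope classical_set_scope.
Local Open Scope ring_scope.
Local Open Scope ereal_scope.

Section ApproachSpaces.
Context {R : realType}.

Definition enlarge (X : Type) (delta : X -> set X -> \bar R) (A : set X)
  (eps : \bar R) : set X := [set x | delta x A <= eps].

(* An approach space is a pair (X, delta) with delta : distance R X. *)
Record distance (X : Type) := Distance {
  dist_fun :> X -> set X -> \bar R ;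
  dist_ge0 : forall x A, 0 <= dist_fun x A ;
  dist_set1 : forall x, dist_fun x [set x] = 0 ;
  dist_set0 : forall x, dist_fun x set0 = +oo ;
  dist_setU : forall x A B,
    dist_fun x (A `|` B) = mine (dist_fun x A) (dist_fun x B) ;
  dist_enlarge : forall x A eps, 0 <= eps ->
    dist_fun x A <= dist_fun x (enlarge dist_fun A eps) + eps }.

Definition approach_contraction (X Y : Type) (dX : distance X) (dY : distance Y)
  (f : X -> Y) : Prop :=
  forall (x : X) (A : set X), dY (f x) (f @` A) <= dX x A.

Section Subspace.
Variables (X : Type) (delta : distance X) (Y : set X).

Let sub_fun (y : Y) (A : set Y) : \bar R := delta (\val y) (\val @` A).

Let sub_ge0 y A : 0 <= sub_fun y A.
Proof. exact: dist_ge0. Qed.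

Let sub_set1 y : sub_fun y [set y] = 0.
Proof. by rewrite /sub_fun image_set1 dist_set1. Qed.

Let sub_set0 y : sub_fun y set0 = +oo.
Proof. by rewrite /sub_fun image_set0 dist_set0. Qed.

Let sub_setU y A B : sub_fun y (A `|` B) = mine (sub_fun y A) (sub_fun y B).
Proof. by rewrite /sub_fun image_setU dist_setU. Qed.

Lemma le_dist x (A B : set X) : A `<=` B -> delta x B <= delta x A.
Proof. by move=> /setUidPr <-; rewrite dist_setU ge_min lexx. Qed.

Let sub_enlarge y A eps : 0 <= eps ->
  sub_fun y A <= sub_fun y (enlarge sub_fun A eps) + eps.
Proof.
move=> eps0; apply: le_trans (dist_enlarge delta _ _ eps0) _.
by rewrite leeD2r// le_dist// => _ [z zA <-].
Qed.

Definition sub_distance : distance Y :=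
  Distance sub_ge0 sub_set1 sub_set0 sub_setU sub_enlarge.

End Subspace.

Section Metric.
Variable Z : metricType R.

Let metric_fun (z : Z) (A : set Z) : \bar R :=
  ereal_inf [set (mdist z a)%:E | a in A].

Let metric_ge0 z A : 0 <= metric_fun z A.
Proof. by apply: le_ereal_inf_tmp => _ [a _ <-]; rewrite lee_fin mdist_ge0. Qed.

Let metric_set1 z : metric_fun z [set z] = 0.
Proof. by rewrite /metric_fun image_set1 ereal_inf1 mdistxx. Qed.

Let metric_set0 z : metric_fun z set0 = +oo.
Proof. by rewrite /metric_fun image_set0 ereal_inf0. Qed.

Let metric_setU z A B :
  metric_fun z (A `|` B) = mine (metric_fun z A) (metric_fun z B).
Proof.
apply/eqP; rewrite eq_le; apply/andP; split.
  by rewrite le_min; apply/andP; split; apply: ereal_inf_le_tmp;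
    apply: image_subset => a; [left|right].
apply: le_ereal_inf_tmp => _ [a [Aa|Ba] <-]; rewrite ge_min; apply/orP.
  by left; apply: ereal_inf_lbound; exists a.
by right; apply: ereal_inf_lbound; exists a.
Qed.

Let metric_enlarge z A eps : 0 <= eps ->
  metric_fun z A <= metric_fun z (enlarge metric_fun A eps) + eps.
Proof.
case: eps => [e e0|_|//]; last first.
  by rewrite addey ?leey// gt_eqF// (lt_le_trans _ (metric_ge0 _ _)).
rewrite -leeBlDr//; apply: le_ereal_inf_tmp => _ [b bA <-].
rewrite leeBlDr//; apply/lee_addgt0Pr => t t0.
have /ereal_inf_lt[_ [a Aa <-] ab] : metric_fun b A < (e + t)%:E.
  by apply: le_lt_trans bA _; rewrite lte_fin ltrDl.
apply: (@le_trans _ _ (mdist z a)%:E); first by apply: ereal_inf_lbound; exists a.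
rewrite -!EFinD lee_fin (le_trans (metric_triangle _ b _))// -addrA lerD2l.
by rewrite ltW.
Qed.

Definition metric_distance : distance Z :=
  Distance metric_ge0 metric_set1 metric_set0 metric_setU metric_enlarge.

End Metric.

(* The metric of R^o is |x - y|. *)
Definition euclidean_interval (gamma : R) : distance `[0%R, gamma]%classic :=
  sub_distance (metric_distance R^o) `[0%R, gamma]%classic.

Section Normality.
Variables (X : Type) (delta : distance X).

Definition gamma_separated (gamma : R) (A B : set X) : Prop :=
  forall alpha beta : R, (0 <= alpha)%R -> (0 <= beta)%R ->
    (alpha + beta < gamma)%R ->
    enlarge delta A alpha%:E `&` enlarge delta B beta%:E = set0.

Definition contractive_scale (F : rat -> set X) : Prop :=
  [/\ \bigcup_q F q = [set: X], \bigcap_q F q = set0 &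
    forall r s : rat, (r < s)%R -> gamma_separated (ratr (s - r)) (F r) (~` F s)].

Definition approach_normal : Prop :=
  forall (A B : set X) (gamma : R), (0 < gamma)%R -> gamma_separated gamma A B ->
  exists F : rat -> set X,
    [/\ contractive_scale F,
        forall q : rat, (q < 0)%R -> F q = set0,
        A `<=` \bigcap_(q in [set q : rat | (0 <= q)%R]) F q &
        B `&`
          \bigcup_(r in [set r : rat | (0 < r)%R /\ (ratr r <= gamma)%R]) F r
          = set0].

End Normality.

Section Developments.
Variable Y : Type.

Definition theta (M : set Y) (y : Y) : \bar R := if y \in M then 0 else +oo.

(* The data (n, m, M) of a function \bigwedge_i (m_i + theta_{M_i}). *)
Record step_function := StepFunction {
  step_size : nat ;
  step_val : 'I_step_size -> R ;
  step_block : 'I_step_size -> set Y ;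
  step_val_ge0 : forall i, (0 <= step_val i)%R ;
  step_block_partition : partition [set: 'I_step_size] step_block [set: Y] }.

Definition step_fun (mu : step_function) (y : Y) : \bar R :=
  \big[mine/+oo]_(i < step_size mu) ((step_val i)%:E + theta (step_block i) y).

(* Only the values of mu at 0 < eps < 1 matter. *)
Definition development (f : Y -> \bar R) (mu : R -> step_function) : Prop :=
  forall eps : R, (0 < eps < 1)%R ->
  forall y, step_fun (mu eps) y <= f y /\ f y <= step_fun (mu eps) y + eps%:E.

End Developments.

Definition tietze_extension (X : Type) (delta : distance X) : Prop :=
  forall (Y : set X) (gamma : R), (0 <= gamma)%R ->
  forall f : Y -> `[0%R, gamma]%classic,
  approach_contraction (sub_distance delta Y) (euclidean_interval gamma) f ->
  (exists mu : R -> step_function Y,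
    development (fun y => (\val (f y))%:E) mu /\
    forall x : X, ~ Y x -> forall eps : R, (0 < eps < 1)%R ->
    forall l k : 'I_(step_size (mu eps)),
      (step_val l - step_val k)%:E <=
        delta x (\val @` step_block k) + delta x (\val @` step_block l)) ->
  exists g : X -> `[0%R, gamma]%classic,
    approach_contraction delta (euclidean_interval gamma) g /\
    forall y : Y, g (\val y) = f y.

End ApproachSpaces.

Arguments distance : clear implicits.

(* Main.v *)
Require Import Defs.
From mathcomp Require Import all_boot all_order all_algebra.
From mathcomp Require Import all_classical all_reals all_analysis.
From mathcomp Require Import lra.

(** Everything is reduced to real-valued contractions and to the separation of
their level sets.  A map [h] into the real line is a contraction exactly when
[h x] is at most [t + delta x A] for every upper bound [t] of [h] on [A], and
dually for lower bounds; in this one-sided form, contractions are visibly stable under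
finite minima and maxima, translations and uniform limits.

Normality is a Urysohn property ([normal_urysohn]): if [A] and [B] are
[(s - r)]-separated, some contraction is at most [r] on [A] and at least [s]
on [B].  It is read off a contractive scale [F] as [x |-> inf {q | F q x}].

Normality implies Tietze.  The hypothesis on developments says that the sets
[{f <= r}] and [{f >= s}], seen in the whole space, are [(s - r)]-separated
([development_separated]): the distance to a set covered by finitely many
blocks of the development is attained on one of them, and the values of [f] on
a block are known up to [eps]; at the points of [Y] itself, the separation
comes from [f] being a contraction.  A finite lattice combination of Urysohn
functions then realises the constraints [h <= c i] on [{f <= c i}] and
[c j <= h] on [{f >= c j}] for a finite grid [c]
([finite_interpolation]), so [h] extends [f] up to the mesh of the grid.  An
exact extension is the limit of such approximate ones.  Since contractions
cannot be added, the usual series of corrections is not available; instead each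
new approximation is clamped into a small band around the previous one, which
makes the sequence uniformly convergent without moving it away from [f]
([extension_from_approximations]).

Tietze implies normality.  The function equal to [0] on [A] and to [gamma] on
[B] is its own development, with [A] and [B] as blocks, and the condition on
this development follows from the [gamma]-separation of [A] and [B].  The strict
sublevel sets of an extension [h], enlarged by [{h = 0}] at nonnegative indices,
form the required scale. *)

Import Order.TTheory GRing.Theory Num.Theory.
Local Open Scope classical_set_scope.
Local Open Scope ring_scope.

Set Implicit Arguments.
Unset Strict Implicit.
Unset Printing Implicit Defensive.

(** * Real-valued contractions *)

Section RealContractions.
Context {R : realType} {X : Type}.
Implicit Types (delta : distance R X) (h : X -> R) (A B : set X).

(** One half of being a contraction into the real line.  Bounding [h] on a set by
a level, instead of taking distances to an image, makes this condition stable
under lattice operations. *)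
Definition upper_contraction delta h :=
  forall x A (c t : R), (delta x A <= c%:E)%E ->
    (forall a, A a -> h a <= t) -> h x <= t + c.

Definition real_contraction delta h :=
  upper_contraction delta h /\ upper_contraction delta (fun x => - h x).

Lemma real_contraction_lower delta h x A (c t : R) : real_contraction delta h ->
  (delta x A <= c%:E)%E -> (forall a, A a -> t <= h a) -> t - c <= h x.
Proof.
move=> [_ ch] xA At; rewrite -lerN2 opprB addrC.
by apply: (ch _ _ _ _ xA) => a /At; rewrite lerN2.
Qed.

Lemma dist_le_ge0 delta x A (c : R) : (delta x A <= c%:E)%E -> 0 <= c.
Proof. by rewrite -lee_fin; apply: le_trans; exact: dist_ge0. Qed.

Lemma dist_le_nonempty delta x A (c : R) : (delta x A <= c%:E)%E -> A !=set0.
Proof. by move=> xA; apply/set0P/eqP => A0; rewrite A0 dist_set0 in xA. Qed.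

Lemma dist_mem delta x A (c : R) : 0 <= c -> A x -> (delta x A <= c%:E)%E.
Proof.
move=> c0 Ax; apply: (@le_trans _ _ 0%E); last by rewrite lee_fin.
by rewrite -(dist_set1 delta x) le_dist// => _ ->.
Qed.

(** A distance turns finite unions into minima, so one piece of a finite cover is
as close as the whole set. *)
Lemma dist_finite_cover delta x (I : eqType) (s : seq I) (M : I -> set X) A (c : R) :
  (forall a, A a -> exists2 i, i \in s & M i a) -> (delta x A <= c%:E)%E ->
  exists i, (delta x (A `&` M i) <= c%:E)%E.
Proof.
elim: s A => [|i s IH] A cov xA.
  by have [a /cov[]] := dist_le_nonempty xA.
have : (delta x (A `&` M i `|` A `\` M i) <= c%:E)%E by rewrite setUIDK.
rewrite dist_setU ge_min => /orP[xAi|xAD]; first by exists i.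
have [|j xj] := IH _ _ xAD.
  by move=> a [/cov[j]]; rewrite inE => /orP[/eqP->//|js Mj] _; exists j.
by exists j; apply: le_trans xj; apply: le_dist => a [[]].
Qed.

Lemma real_contractionN delta h :
  real_contraction delta h -> real_contraction delta (fun x => - h x).
Proof.
by move=> [h1 h2]; split=> //; under eq_fun do rewrite opprK.
Qed.

Lemma real_contractionD delta h (k : R) :
  real_contraction delta h -> real_contraction delta (fun x => h x + k).
Proof.
move=> [h1 h2]; split=> x A c t xA At.
  rewrite -lerBrDr addrAC; apply: (h1 _ _ _ _ xA) => a /At.
  by rewrite lerBrDr.
rewrite opprD lerBlDr addrAC; apply: (h2 _ _ _ _ xA) => a /At.
by rewrite opprD lerBlDr.
Qed.

Lemma real_contraction_cst delta (k : R) : real_contraction delta (fun=> k).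
Proof.
by split=> x A c t xA At; have [a /At kt] := dist_le_nonempty xA;
  rewrite (le_trans kt)// lerDl (dist_le_ge0 xA).
Qed.

(** Where a minimum is at most [t], one of the two functions is: the set splits
into two pieces, one of which realises the distance. *)
Lemma real_contraction_min delta h1 h2 :
  real_contraction delta h1 -> real_contraction delta h2 ->
  real_contraction delta (fun x => Num.min (h1 x) (h2 x)).
Proof.
move=> c1 c2; split=> x A c t xA At.
  pose M (b : bool) := [set a | (if b then h1 a else h2 a) <= t].
  have : exists b, (delta x (A `&` M b) <= c%:E)%E.
    apply: (@dist_finite_cover _ _ _ [:: true; false] M) xA.
    move=> a /At; rewrite ge_min => /orP[ht|ht]; [exists true|exists false] => //.
  move=> [[] xb]; rewrite ge_min; apply/orP; [left|right].
    by apply: c1.1 xb _ => a [].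
  by apply: c2.1 xb _ => a [].
rewrite lerNl le_min opprD; apply/andP; split.
  apply: real_contraction_lower c1 xA _ => a /At.
  by rewrite lerNl le_min => /andP[].
apply: real_contraction_lower c2 xA _ => a /At.
by rewrite lerNl le_min => /andP[].
Qed.

Lemma real_contraction_max delta h1 h2 :
  real_contraction delta h1 -> real_contraction delta h2 ->
  real_contraction delta (fun x => Num.max (h1 x) (h2 x)).
Proof.
move=> /real_contractionN c1 /real_contractionN c2.
have -> : (fun x => Num.max (h1 x) (h2 x)) =
          fun x => - Num.min (- h1 x) (- h2 x).
  by apply/funext => x; rewrite oppr_min !opprK.
exact/real_contractionN/real_contraction_min.
Qed.

Lemma real_contraction_uniform delta h :
  (forall e : R, 0 < e ->
     exists2 k, real_contraction delta k & forall x, `|h x - k x| <= e) ->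
  real_contraction delta h.
Proof.
move=> approx; split=> x A c t xA At; apply/ler_addgt0Pr => e e0;
  have [|k [k1 k2] hk] := approx (e / 2); rewrite ?divr_gt0//.
  have := k1 x A c (t + e / 2) xA.
  have := hk x; rewrite ler_norml => ? H; have {}H : k x <= t + e / 2 + c.
    by apply: H => a /At; have := hk a; rewrite ler_norml; lra.
  lra.
have := k2 x A c (t + e / 2) xA.
have := hk x; rewrite ler_norml => ? H; have {}H : - k x <= t + e / 2 + c.
  by apply: H => a /At; have := hk a; rewrite ler_norml; lra.
lra.
Qed.

(** Given approximations [h n] of [f] up to [2 ^- n], the function [h n.+1] is
clamped between [G n - 2 ^- n] and [G n + 2 ^- n], where [G n] is the previous
member of the new sequence.  As [f] itself lies in this band, clamping does not
worsen the approximation of [f]; and the new sequence is uniformly Cauchy on the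
whole space. *)
Lemma extension_from_approximations delta (Y : Type) (i : Y -> X) (f : Y -> R) :
  (forall e : R, 0 < e ->
     exists2 h, real_contraction delta h & forall y, `|h (i y) - f y| <= e) ->
  exists2 g, real_contraction delta g & forall y, g (i y) = f y.
Proof.
move=> approx; pose e n : R := 2 ^- n.
have e0 n : 0 < e n by rewrite invr_gt0 exprn_gt0.
have e2 n : e n = e n.+1 + e n.+1.
  by rewrite /e exprS invfM; lra.
have small d : 0 < d -> exists n, e n + e n < d.
  move=> d0; exists (Num.bound d^-1).+1; rewrite -e2 /e invf_plt ?posrE ?exprn_gt0//.
  exact: upper_nthrootP.
have /choice[h hP] (n : nat) : exists h,
    real_contraction delta h /\ forall y, `|h (i y) - f y| <= e n.
  by have [h ? ?] := approx _ (e0 n); exists h.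
pose G := fix G n : X -> R := if n is m.+1 then
  fun x => Num.max (G m x - e m) (Num.min (G m x + e m) (h m.+1 x)) else h 0%N.
have Gc n : real_contraction delta (G n).
  elim: n => [|n IH] /=; first exact: (hP 0%N).1.
  apply: real_contraction_max; first exact: real_contractionD.
  apply: real_contraction_min; first exact: real_contractionD.
  exact: (hP n.+1).1.
have Gstep n x : G n x - e n <= G n.+1 x <= G n x + e n.
  rewrite /= le_max lexx ge_max ge_min lexx /= !andbT.
  by have := e0 n; lra.
have Gf n y : `|G n (i y) - f y| <= e n.
  elim: n => [|n]; first exact: (hP 0%N).2.
  have := (hP n.+1).2 y; rewrite !ler_norml /= => H1 H2.
  have en := e0 n; have en1 := e0 n.+1.
  case: (leP (G n (i y) + e n) (h n.+1 (i y))) => ? /=;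
    by rewrite /Num.max; case: ifP => [|/negbT]; rewrite -?leNgt => ?; lra.
(* Steps are at most [e n], with sum of the remaining ones [e n + e n]: these
   bounds bracket the limit, which is therefore a supremum. *)
pose lo n x := G n x - (e n + e n); pose hi n x := G n x + (e n + e n).
have lo_incr x : {homo lo ^~ x : n m / (n <= m)%N >-> n <= m}.
  apply: (@homo_leq _ (lo ^~ x) (fun a b => a <= b)) => [//|b a c ab bc|n].
    exact: le_trans bc.
  by rewrite /lo; have := Gstep n x; have := e2 n; lra.
have hi_decr x : {homo hi ^~ x : n m / (n <= m)%N >-> m <= n}.
  apply: (@homo_leq _ (hi ^~ x) (fun a b => b <= a)) => [//|b a c ab bc|n].
    exact: le_trans bc ab.
  by rewrite /hi; have := Gstep n x; have := e2 n; lra.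
have lohi x n m : lo n x <= hi m x.
  apply: le_trans (lo_incr x _ _ (leq_maxl n m)) _.
  apply: le_trans (hi_decr x _ _ (leq_maxr n m)).
  by rewrite /lo /hi; have := e0 (maxn n m); lra.
pose g x := sup (range (lo ^~ x)).
have gG n x : `|g x - G n x| <= e n + e n.
  rewrite ler_distl; apply/andP; split.
    apply: ub_le_sup; last by exists n.
    by exists (hi 0%N x) => _ [m _ <-].
  by apply: ge_sup => [|_ [m _ <-]]; [exists (lo 0%N x), 0%N|exact: lohi].
exists g => [|y].
  apply: real_contraction_uniform => d /small[n nd].
  by exists (G n) => // x; apply: le_trans (gG n x) (ltW nd).
apply/eqP; rewrite -subr_eq0 -normr_le0; apply/ler_addgt0Pr => d d0; rewrite add0r.
have [|n] := small (d / 2); first by rewrite divr_gt0.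
have := gG n (i y); have := Gf n y; have := e0 n; rewrite !ler_norml; lra.
Qed.

(** If every point of [A] had its value further than [delta x A + e] from that of
[x], then [A] would split into a part with too small and a part with too large
values; one of them is as close to [x] as [A], which contradicts one of the two
half conditions. *)
Lemma approach_contractionP delta (gamma : R) (g : X -> `[0%R, gamma]%classic) :
  approach_contraction delta (euclidean_interval gamma) g <->
  real_contraction delta (fun x => \val (g x)).
Proof.
have distE z (C : set X) : euclidean_interval gamma z (g @` C) =
    ereal_inf [set (`|\val z - \val (g a)|)%:E | a in C].
  rewrite /= !image_comp; congr ereal_inf; apply: eq_imagel => a _ /=.
  by congr EFin; exact: distrC.
split=> [cg|[up low]].
  have near x A c (e : R) : (delta x A <= c%:E)%E -> 0 < e ->
      exists2 a, A a & `|\val (g x) - \val (g a)| < c + e.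
    move=> xA e0.
    have /ereal_inf_lt[_ [a Aa <-] h] : (ereal_inf
       [set (`|\val (g x) - \val (g a)|)%:E | a in A] < (c + e)%:E)%E.
      by rewrite -distE (le_lt_trans (cg _ _))// (le_lt_trans xA)// lte_fin ltrDl.
    by exists a; rewrite // -lte_fin.
  by split=> x A c t xA At; apply/ler_addgt0Pr => e e0;
    have [a /At] := near _ _ _ _ xA e0; rewrite ltr_norml; lra.
move=> x A; rewrite distE.
have := dist_ge0 delta x A; case xA : (delta x A) => [c| |] // _; last exact: leey.
apply/lee_addgt0Pr => e e0; rewrite leNgt; apply/negP => far.
have {}far a : A a -> c + e < `|\val (g x) - \val (g a)|.
  by move=> Aa; rewrite -lte_fin (lt_le_trans far)//; apply: ereal_inf_lbound; exists a.
pose M (b : bool) := [set a | if b then \val (g a) <= \val (g x) - (c + e)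
                              else \val (g x) + (c + e) <= \val (g a)].
have : exists b, (delta x (A `&` M b) <= c%:E)%E.
  apply: (@dist_finite_cover _ _ _ [:: true; false] M).
    by move=> a /far; rewrite ltr_normr => /orP[H|H]; [exists true|exists false];
      rewrite // /M /=; move: H => /=; lra.
  by rewrite xA.
move=> [[] xb].
  have := up _ _ _ _ xb (fun a => @proj2 _ _); lra.
have := real_contraction_lower (conj up low) xb (fun a => @proj2 _ _); lra.
Qed.

End RealContractions.

(** * Urysohn functions and approximate extensions *)

Section Separation.
Context {R : realType} {X : Type}.
Implicit Types (delta : distance R X) (h : X -> R) (A B : set X).

(** The form in which separation is used: [gamma <= delta x A + delta x B], with
the distances replaced by finite upper bounds to stay within the reals. *)
Lemma gamma_separatedP delta (gamma : R) A B :
  gamma_separated delta gamma A B <->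
  forall x (a b : R), (delta x A <= a%:E)%E -> (delta x B <= b%:E)%E ->
    gamma <= a + b.
Proof.
split=> [sep x a b xA xB|sep a b _ _ ab].
  rewrite leNgt; apply/negP => ab.
  have : (enlarge delta A a%:E `&` enlarge delta B b%:E) x by [].
  by rewrite (sep _ _ (dist_le_ge0 xA) (dist_le_ge0 xB) ab).
apply/seteqP; split=> // x [xA xB].
by have := sep x a b xA xB; rewrite leNgt ab.
Qed.

Lemma real_contraction_separated delta h A B (r s : R) :
  real_contraction delta h -> (forall x, A x -> h x <= r) ->
  (forall x, B x -> s <= h x) -> gamma_separated delta (s - r) A B.
Proof.
move=> ch Ar Bs; apply/gamma_separatedP => x a b xA xB.
have := ch.1 _ _ _ _ xA Ar; have := real_contraction_lower ch xB Bs; lra.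
Qed.

Lemma contractive_scale_incr delta (F : rat -> set X) (p q : rat) :
  contractive_scale delta F -> p <= q -> F p `<=` F q.
Proof.
move=> [_ _ sep]; rewrite le_eqVlt => /orP[/eqP->//|pq] x Fpx.
apply: contrapT => nFqx.
have := (gamma_separatedP _ _ _ _).1 (sep _ _ pq) x 0 0 (dist_mem _ (lexx _) Fpx)
  (dist_mem (A := ~` F q) _ (lexx _) nFqx).
by rewrite addr0 leNgt ltr0q subr_gt0 pq.
Qed.

Definition scale_fun (F : rat -> set X) (x : X) : R :=
  inf [set ratr q | q in [set q | F q x]].

Section ScaleFun.
Variables (delta : distance R X) (F : rat -> set X).
Hypothesis scaleF : contractive_scale delta F.
Hypothesis F_lt0 : forall q : rat, q < 0 -> F q = set0.

Lemma scale_lbound0 x : lbound [set (ratr q : R) | q in [set q | F q x]] 0.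
Proof.
move=> _ [q /= Fqx <-]; rewrite ler0q leNgt; apply/negP => /F_lt0 Fq0.
by rewrite Fq0 in Fqx.
Qed.

Lemma scale_fun_le x (q : rat) : F q x -> scale_fun F x <= ratr q.
Proof. by move=> Fqx; apply: ge_inf; [exists 0; exact: scale_lbound0|exists q]. Qed.

Lemma scale_fun_ge0 x : 0 <= scale_fun F x.
Proof.
have [p _ Fpx] : (\bigcup_q F q) x by have [-> _ _] := scaleF.
by apply: lb_le_inf; [exists (ratr p), p|exact: scale_lbound0].
Qed.

Lemma scale_fun_lt x (q : rat) : scale_fun F x < ratr q -> F q x.
Proof.
have [p _ Fpx] : (\bigcup_q F q) x by have [-> _ _] := scaleF.
move=> /inf_lt[|_ [r Frx <-]]; first by exists (ratr p), p.
by rewrite ltr_rat => /ltW rq; exact: contractive_scale_incr scaleF rq _ Frx.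
Qed.

(** Between a bound [t] for the function on [A] and its value at [x] there is
room for two rational indices [r < s] with [s - r] larger than the distance [c]
if the contraction inequality fails by any amount.  Then [x] is within [c] of
[F r] and outside [F s], or the other way round, against separation. *)
Lemma scale_fun_contraction : real_contraction delta (scale_fun F).
Proof.
have [_ _ sep] := scaleF.
have key (u v c : R) : 0 <= c -> c < v - u -> exists r s : rat,
    [/\ r < s, u < ratr r, ratr s < v & c < ratr (s - r)].
  move=> c0 cuv; pose d := (v - u - c) / 2.
  have [|r /itvP ur] := @rat_in_itvoo R u (u + d); first by rewrite /d; lra.
  have [|s /itvP sv] := @rat_in_itvoo R (v - d) v; first by rewrite /d; lra.
  have crs : c < ratr (s - r).
    have : ratr r < u + d by rewrite ur.
    have : v - d < ratr s by rewrite sv.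
    rewrite /d rmorphB; lra.
  exists r, s; rewrite ur sv crs; split=> //.
  by rewrite -subr_gt0 -(@ltr0q R); exact: le_lt_trans crs.
split=> x A c t xA At; rewrite leNgt; apply/negP => tc; have c0 := dist_le_ge0 xA.
  have [|r [s [rs tr sx crs]]] := key t (scale_fun F x) c c0; first by lra.
  have xr : (delta x (F r) <= c%:E)%E.
    apply: le_trans xA; apply: le_dist => a /At fat.
    by apply: scale_fun_lt; exact: le_lt_trans tr.
  have xs : (delta x (~` F s) <= 0%:E)%E.
    apply: dist_mem => // Fsx; have := scale_fun_le Fsx; lra.
  by have := (gamma_separatedP _ _ _ _).1 (sep _ _ rs) _ _ _ xr xs; lra.
have [|r [s [rs xr st crs]]] := key (scale_fun F x) (- t) c c0; first by lra.
have Frx : (delta x (F r) <= 0%:E)%E by apply: dist_mem => //; exact: scale_fun_lt.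
have xs : (delta x (~` F s) <= c%:E)%E.
  apply: le_trans xA; apply: le_dist => a /At fat Fsa.
  by have := scale_fun_le Fsa; lra.
by have := (gamma_separatedP _ _ _ _).1 (sep _ _ rs) _ _ _ Frx xs; lra.
Qed.

End ScaleFun.

(** When [s <= r] a constant is enough; allowing this case spares all order
conditions on the levels of an interpolation problem. *)
Lemma normal_urysohn delta A B (r s : R) : approach_normal delta ->
  gamma_separated delta (s - r) A B ->
  exists h, [/\ real_contraction delta h, forall x, A x -> h x <= r &
    forall x, B x -> s <= h x].
Proof.
move=> normal sep; have [sr|rs] := leP s r.
  by exists (fun=> s); split=> //; exact: real_contraction_cst.
have [|F [scaleF F_lt0 AF BF]] := normal A B (s - r) _ sep.
  by rewrite subr_gt0.
exists (fun x => scale_fun F x + r); split=> [|x Ax|x Bx].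
- exact/real_contractionD/(scale_fun_contraction scaleF).
- have := scale_fun_le F_lt0 (AF x Ax 0 (lexx _)); rewrite rmorph0; lra.
rewrite -lerBlDr leNgt; apply/negP => fx.
have [q /itvP q_itv] := rat_in_itvoo fx.
have fxq : scale_fun F x < ratr q by rewrite q_itv.
have Fqx := scale_fun_lt scaleF fxq.
suff : set0 x by [].
rewrite -BF; split=> //; exists q => //=; split; last by rewrite q_itv.
rewrite -(@ltr0q R); apply: le_lt_trans fxq.
exact: scale_fun_ge0 scaleF F_lt0 x.
Qed.

(** For a fixed [j], the minimum over [i] of the Urysohn functions of the pairs
[(A i, B j)] satisfies all upper constraints and the lower constraint of [j]; the
maximum over [j] of these minima satisfies everything. *)
Lemma finite_interpolation delta (A B : nat -> set X) (c : nat -> R) (m n : nat) :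
  approach_normal delta -> (forall i, 0 <= c i) ->
  (forall i j, gamma_separated delta (c j - c i) (A i) (B j)) ->
  exists2 h, real_contraction delta h &
    (forall i x, (i < m)%N -> A i x -> h x <= c i) /\
    (forall j x, (j < n)%N -> B j x -> c j <= h x).
Proof.
move=> normal c0 sep; elim: n => [|n [h ch [hA hB]]].
  by exists (fun=> 0); [exact: real_contraction_cst|].
have [k ck [kA kB]] : exists2 k, real_contraction delta k &
    (forall i x, (i < m)%N -> A i x -> k x <= c i) /\
    (forall x, B n x -> c n <= k x).
  elim: {hA} m => [|m [k ck [kA kB]]].
    by exists (fun=> c n); [exact: real_contraction_cst|].
  have [u [cu uA uB]] := normal_urysohn normal (sep m n).
  exists (fun x => Num.min (k x) (u x)); first exact: real_contraction_min.
  split=> [i x|x Bx]; last by rewrite le_min kB ?uB.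
  rewrite ltnS leq_eqVlt ge_min => /orP[/eqP->|im] Aix; apply/orP.
    by right; exact: uA.
  by left; exact: kA.
exists (fun x => Num.max (h x) (k x)); first exact: real_contraction_max.
split=> [i x im Aix|j x]; first by rewrite ge_max hA ?kA.
rewrite ltnS leq_eqVlt le_max => /orP[/eqP->|jn] Bjx; apply/orP.
  by right; exact: kB.
by left; exact: hB.
Qed.

(** If [k e <= f y < (k + 1) e], interpolation on the grid of mesh [e] puts the
value at [y] between the same two grid points. *)
Lemma approximate_extension delta (Y : Type) (i : Y -> X) (f : Y -> R) (gamma e : R) :
  approach_normal delta -> (forall y, 0 <= f y <= gamma) ->
  (forall r s, gamma_separated delta (s - r)
     (i @` [set y | f y <= r]) (i @` [set y | s <= f y])) ->
  0 < e ->
  exists2 h, real_contraction delta h & forall y, `|h (i y) - f y| <= e.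
Proof.
move=> normal f0g sep e0; pose c k : R := k%:R * e.
pose n := (Num.truncn (gamma / e)).+2.
have [|h ch [hA hB]] := @finite_interpolation delta
    (fun k => i @` [set y | f y <= c k]) (fun k => i @` [set y | c k <= f y]) c n n
    normal _ (fun k l => sep (c k) (c l)).
  by move=> k; rewrite mulr_ge0 ?ler0n// ltW.
exists h => // y; have /andP[fy0 fyg] := f0g y.
pose k := Num.truncn (f y / e).
have /truncn_itv : 0 <= f y / e by rewrite divr_ge0// ltW.
rewrite -/k ler_pdivlMr// ltr_pdivrMr// => /andP[ck fck].
have kn : (k.+1 < n)%N.
  by rewrite !ltnS le_truncn// ler_pM2r// invr_gt0.
have := hA k.+1 (i y) kn (ex_intro2 _ _ y (ltW fck) erefl).
have := hB k (i y) (ltnW kn) (ex_intro2 _ _ y ck erefl).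
move: fck; rewrite ler_norml /c -natr1; lra.
Qed.

End Separation.

(** * Equivalence of normality and extension *)

Section Tietze.
Context {R : realType} {X : Type}.
Implicit Types (delta : distance R X) (A B Y : set X).

Lemma le_adde_fin (u v : \bar R) (r : R) : (0 <= u)%E -> (0 <= v)%E ->
  (forall a b : R, (u <= a%:E)%E -> (v <= b%:E)%E -> r <= a + b) ->
  (r%:E <= u + v)%E.
Proof.
case: u v => [a| |] [b| |] //= _ _ H; rewrite ?leey//.
by rewrite -EFinD lee_fin H.
Qed.

Lemma step_fun_block (Y : Type) (mu : @step_function R Y)
    (i : 'I_(step_size mu)) y :
  step_block i y -> step_fun mu y = (step_val i)%:E.
Proof.
move=> iy; have [_ triv _] := step_block_partition mu.
apply/eqP; rewrite eq_le; apply/andP; split.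
  by apply: (@bigmin_inf _ _ _ _ i) => //; rewrite /theta mem_set// adde0.
apply: le_bigmin => [|j _]; first exact: leey.
rewrite /theta; case: ifP => [/set_mem jy|_]; last by rewrite addey ?leey.
by rewrite adde0 (triv i j)//; exists y.
Qed.

Lemma step_block_cover (Y : Type) (mu : @step_function R Y) y :
  exists i : 'I_(step_size mu), step_block i y.
Proof.
have [+ _ _] := step_block_partition mu => /seteqP[_ /(_ y Logic.I)].
by move=> [i _ iy]; exists i.
Qed.

(** Off [Y], let the blocks [k] and [l] be as close to [x] as the two level sets
which they meet.  Then [m_k <= r] and [s <= m_l + e], so that the condition on
the development bounds [s - r - e] by the sum of the distances. *)
Lemma development_separated delta Y (f : Y -> R) :
  real_contraction (sub_distance delta Y) f ->
  (exists mu : R -> step_function Y,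
    development (fun y => (f y)%:E) mu /\
    forall x : X, ~ Y x -> forall eps : R, 0 < eps < 1 ->
    forall l k : 'I_(step_size (mu eps)),
      ((step_val l - step_val k)%:E <=
        delta x (\val @` step_block k) + delta x (\val @` step_block l))%E) ->
  forall r s, gamma_separated delta (s - r)
    (\val @` [set y | f y <= r]) (\val @` [set y | s <= f y]).
Proof.
move=> cf [mu [dev mud]] r s; apply/gamma_separatedP => x a b xr xs.
have [Yx|nYx] := pselect (Y x).
  pose y : Y := SigSub (mem_set Yx).
  have fyr : f y <= r + a by apply: (cf.1 y [set y | f y <= r]).
  have fys : s - b <= f y.
    exact: (real_contraction_lower (x := y) (A := [set y | s <= f y]) cf).
  by lra.
apply/ler_addgt0Pr => e0 e0_gt0; pose e := Num.min e0 (2^-1).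
have e_gt0 : 0 < e by rewrite lt_min e0_gt0; lra.
have ee0 : e <= e0 by rewrite ge_min lexx.
have e12 : e <= 2^-1 by rewrite ge_min lexx orbT.
have e01 : 0 < e < 1 by lra.
pose M (i : 'I_(step_size (mu e))) := \val @` step_block i.
have pick_block c (S : set Y) : (delta x (\val @` S) <= c%:E)%E ->
    exists i, (delta x (M i) <= c%:E)%E /\ exists2 y, S y & step_block i y.
  move=> xS; have [|i xi] := dist_finite_cover (s := enum 'I__) (M := M) _ xS.
    move=> _ [y _ <-]; have [i iy] := step_block_cover (mu e) y.
    by exists i; [rewrite mem_enum|exists y].
  exists i; split; first by apply: le_trans xi; apply: le_dist => ? [].
  by have [_ [[y Sy <-] [z iz /val_inj zy]]] := dist_le_nonempty xi;
    exists y; rewrite // -zy.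
have [k [xk [y fyr ky]]] := pick_block _ _ xr.
have [l [xl [z fzs lz]]] := pick_block _ _ xs.
have [+ _] := dev e e01 y; have [_] := dev e e01 z.
rewrite (step_fun_block ky) (step_fun_block lz) -EFinD !lee_fin => fz fy.
have := mud x nYx e e01 l k => /le_trans/(_ (leeD xk xl)).
rewrite -EFinD lee_fin /= in fyr fzs *; lra.
Qed.

Lemma normal_tietze delta : approach_normal delta -> tietze_extension delta.
Proof.
move=> normal Y gamma gamma0 f /approach_contractionP cf dev.
have f0g y : 0 <= \val (f y) <= gamma.
  by have := set_mem (valP (f y)); rewrite /= in_itv.
have sep := development_separated cf dev.
have [h ch hf] := extension_from_approximations
  (fun e e0 => approximate_extension normal f0g sep e0).
pose k x := Num.max 0 (Num.min gamma (h x)).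
have ck : real_contraction delta k.
  by do 2?[apply: real_contraction_max|apply: real_contraction_min] => //;
    exact: real_contraction_cst.
have k0g x : `[0, gamma]%classic (k x).
  by rewrite /= in_itv /= le_max lexx ge_max gamma0 ge_min lexx.
exists (fun x => SigSub (mem_set (k0g x))); split; first exact/approach_contractionP.
move=> y; apply: val_inj; rewrite /= /k hf.
by have /andP[f0 fg] := f0g y; rewrite (min_idPr fg) (max_idPr f0).
Qed.

(** Blocks of a partition are nonempty, so that the two-block development exists
only if both sets are nonempty; otherwise a constant function will do. *)
Lemma tietze_urysohn delta A B (gamma : R) : tietze_extension delta ->
  0 < gamma -> gamma_separated delta gamma A B ->
  exists h, [/\ real_contraction delta h, forall x, 0 <= h x <= gamma,
    forall x, A x -> h x = 0 & forall x, B x -> h x = gamma].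
Proof.
move=> tietze gamma_gt0 /gamma_separatedP sep.
have [A0|/set0P[a0 Aa0]] := eqVneq A set0.
  exists (fun=> gamma); split=> [|_|x|//]; last by rewrite A0.
    exact: real_contraction_cst.
  by rewrite lexx ltW.
have [B0|/set0P[b0 Bb0]] := eqVneq B set0.
  exists (fun=> 0); split=> [|_|//|x]; last by rewrite B0.
    exact: real_contraction_cst.
  by rewrite lexx ltW.
have AB x : A x -> ~ B x.
  move=> Ax Bx; have := sep x 0 0 (dist_mem _ (lexx _) Ax) (dist_mem _ (lexx _) Bx).
  by rewrite addr0 leNgt gamma_gt0.
pose Y := A `|` B.
have AY x : A x -> Y x by left.
have BY x : B x -> Y x by right.
pose v (y : Y) : R := if \val y \in A then 0 else gamma.
have v0g y : `[0, gamma]%classic (v y).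
  by rewrite /= in_itv /v; case: ifP => _ /=; rewrite lexx ltW.
have vA (y : Y) : A (\val y) -> v y = 0 by move=> Ay; rewrite /v mem_set.
have vB (y : Y) : B (\val y) -> v y = gamma.
  by rewrite /v; case: ifP => // /set_mem /AB.
have YAB (y : Y) : A (\val y) \/ B (\val y) by have := set_mem (valP y).
pose f (y : Y) : `[0, gamma]%classic := SigSub (mem_set (v0g y)).
have cf : real_contraction (sub_distance delta Y) (fun y => \val (f y)).
  have sub_le (y : Y) (S : set Y) (C : set X) (c : R) :
      (sub_distance delta Y y S <= c%:E)%E -> (forall z, S z -> C (\val z)) ->
      (delta (\val y) C <= c%:E)%E.
    by move=> yS SC; apply: le_trans yS; apply: le_dist => _ [z /SC ? <-].
  split=> y S c t yS St; have c0 := dist_le_ge0 yS;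
    have [z Sz] := dist_le_nonempty yS; have := v0g z; have := St z Sz;
    rewrite /= in_itv /= => zt /andP[z0 zg].
  - have [Ay|By] := YAB y; first by rewrite vA//; lra.
    rewrite vB//; have [|tg] := leP gamma t; first lra.
    have yA := sub_le y S A c yS _.
    have := sep (\val y) c 0 (yA _) (dist_mem _ (lexx _) By).
    suff SA : forall z, S z -> A (\val z) by move=> /(_ SA); lra.
    move=> w Sw; have [//|Bw] := YAB w.
    by have := St w Sw; rewrite /= vB//; lra.
  - have [Ay|By] := YAB y; last by rewrite vB//; lra.
    rewrite vA//; have [|t0] := leP 0 t; first lra.
    have yB := sub_le y S B c yS _.
    have := sep (\val y) 0 c (dist_mem _ (lexx _) Ay) (yB _).
    suff SB : forall z, S z -> B (\val z) by move=> /(_ SB); lra.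
    move=> w Sw; have [Aw|//] := YAB w.
    by have := St w Sw; rewrite /= vA//; lra.
pose val2 (i : 'I_2) : R := if i == ord0 then 0 else gamma.
pose block (i : 'I_2) : set Y := [set y | (if i == ord0 then A else B) (\val y)].
have val2_ge0 i : 0 <= val2 i by rewrite /val2; case: ifP => // _; exact: ltW.
have block_partition : partition [set: 'I_2] block [set: Y].
  split.
  - apply/seteqP; split=> // y _; have [Ay|By] := YAB y.
      by exists ord0.
    by exists (lift ord0 ord0).
  - move=> i j _ _ [y []]; rewrite /block /=.
    have [->|i0] := eqVneq i ord0; have [->|j0] := eqVneq j ord0 => //.
    + by move=> /AB.
    + by move=> By /AB.
    + by move=> _ _; apply/val_inj; move: i j i0 j0 => [[|[|//]] ?] [[|[|//]] ?].
  - move=> i _; rewrite /block; have [_|_] := eqVneq i ord0.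
      by exists (SigSub (mem_set (AY _ Aa0))).
    by exists (SigSub (mem_set (BY _ Bb0))).
pose mu := StepFunction val2_ge0 block_partition.
have muE y : step_fun mu y = (\val (f y))%:E.
  have [Ay|By] := YAB y.
    by rewrite (step_fun_block (mu := mu) (i := ord0))//= vA.
  by rewrite (step_fun_block (mu := mu) (i := lift ord0 ord0))//= vB.
have [|g [/approach_contractionP cg gf]] := tietze Y gamma (ltW gamma_gt0) f
  ((approach_contractionP _ _).2 cf).
  exists (fun=> mu); split=> [e /andP[e0 _] y|x _ e _ l k].
    by rewrite muE lexx leeDl// lee_fin ltW.
  apply: le_adde_fin => [||rk rl xk xl]; [exact: dist_ge0|exact: dist_ge0|].
  have rk0 := dist_le_ge0 xk; have rl0 := dist_le_ge0 xl.
  have blockS i : \val @` block i `<=` if i == ord0 then A else B.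
    by move=> _ [y yi <-].
  move: xk => /(le_trans (le_dist _ _ (blockS k))) xk.
  move: xl => /(le_trans (le_dist _ _ (blockS l))) xl.
  rewrite /= /val2; move: xk xl; case: ifP => _; case: ifP => _; try by lra.
  by rewrite subr0; exact: sep.
exists (fun x => \val (g x)); split=> // [x|x Ax|x Bx].
- by have := set_mem (valP (g x)); rewrite /= in_itv.
- have := gf (SigSub (mem_set (AY _ Ax))); rewrite /= => ->.
  by rewrite /= vA.
have := gf (SigSub (mem_set (BY _ Bx))); rewrite /= => ->.
by rewrite /= vB.
Qed.

(** Neither family of sublevel sets is a suitable scale: [{h < 0}] does not contain
[A], and [{h <= gamma}] contains [B].  Any choice between [{h < q}] and
[{h <= q}] has the separation property, so the strict sets are taken with
[{h = 0}] added at nonnegative indices. *)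
Lemma tietze_normal delta : tietze_extension delta -> approach_normal delta.
Proof.
move=> tietze A B gamma gamma_gt0 sep.
have [h [ch h0g hA hB]] := tietze_urysohn tietze gamma_gt0 sep.
exists (fun q => [set x | 0 <= q /\ (h x = 0 \/ h x < ratr q)]); split.
- split.
  + apply/seteqP; split=> // x _.
    have [|q /itvP hq] := @rat_in_itvoo R (h x) (h x + 1); first by rewrite ltrDl.
    exists q => //; have hxq : h x < ratr q by rewrite hq.
    split; last by right.
    by rewrite -(@ler0q R) (le_trans _ (ltW hxq))//; have /andP[] := h0g x.
  + by apply/seteqP; split=> // x /(_ (-1) Logic.I)[]; rewrite lerNr oppr0.
  + move=> r s rs; rewrite rmorphB; apply: real_contraction_separated ch _ _.
      move=> x [r0 [->|/ltW//]]; by rewrite ler0q.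
    move=> x nFs; rewrite leNgt; apply/negP => hs; apply: nFs.
    split; last by right.
    by rewrite -(@ler0q R) (le_trans _ (ltW hs))//; have /andP[] := h0g x.
- by move=> q q0; apply/seteqP; split=> // x []; rewrite leNgt q0.
- by move=> x /hA hx q q0; split=> //; left.
apply/seteqP; split=> // x [/hB hx [r [r0 rg] [_ []]]]; rewrite hx.
  by move=> g0; rewrite g0 ltxx in gamma_gt0.
by rewrite ltNge rg.
Qed.

End Tietze.

Theorem theorem5p2 (R : realType) (X : Type) (delta : distance R X) :
  approach_normal delta <-> tietze_extension delta.
Proof. by split; [exact: normal_tietze|exact: tietze_normal]. Qed.
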